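(* Let $X$ be a topological space. If $X$ has a zero-set diagonal and $X^2$ has countable weak extent (i.e. $we(X^2)\le\omega$), then $X$ is submetrizable.
   Context: The diagonal of $X^2$ is $\Delta_X=\{(x,x):x\in X\}$. A space $X$ has a zero-set diagonal if there is a continuous function $f:X^2\to[0,1]$ with $\Delta_X=f^{-1}(0)$. For a family $\mathcal{B}$ of subsets of a space $Y$ and $A\subseteq Y$, put $\mathrm{St}(A,\mathcal{B})=\bigcup\{B\in\mathcal{B}:A\cap B\ne\emptyset\}$. The weak extent $we(Y)$ of a space $Y$ is the least cardinal $\kappa$ such that for every open cover $\mathcal{U}$ of $Y$ there is $A\subseteq Y$ with $|A|\le\kappa$ and $\mathrm{St}(A,\mathcal{U})=Y$. A space is submetrizable if it admits a coarser metrizable topology (coarser includes equal). *)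

(* Defs.v *)
From HB Require Import structures.
From mathcomp Require Import all_boot all_order all_algebra.
From mathcomp Require Import all_classical all_reals all_analysis.

Set Implicit Arguments.
Unset Strict Implicit.
Unset Printing Implicit Defensive.

Import Order.TTheory GRing.Theory Num.Theory.
Import numFieldNormedType.Exports.

Local Open Scope classical_set_scope.
Local Open Scope ring_scope.

Definition zero_set_diagonal (R : realType) (X : topologicalType) : Prop :=
  exists f : X * X -> R,
    [/\ continuous f, range f `<=` `[0, 1] & f @^-1` [set 0] = diagonal].

Definition star (T : Type) (A : set T) (B : set (set T)) : set T :=
  \bigcup_(U in [set U | B U /\ A `&` U !=set0]) U.

Definition open_cover (Y : topologicalType) (U : set (set Y)) : Prop :=
  U `<=` open /\ \bigcup_(V in U) V = [set: Y].

(* A cardinal is represented by any set of that cardinality, cardinals being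
   compared with [#<=]. *)
Definition weak_extent_bound (Y : topologicalType) (T : Type) (K : set T) :
    Prop :=
  forall U : set (set Y), open_cover U ->
    exists2 A : set Y, (A #<= K)%card & star A U = [set: Y].

Definition is_weak_extent (Y : topologicalType) (T : Type) (K : set T) : Prop :=
  weak_extent_bound Y K /\
  forall (T' : Type) (K' : set T'), weak_extent_bound Y K' -> (K #<= K')%card.

Definition countable_weak_extent (Y : topologicalType) : Prop :=
  exists (T : Type) (K : set T), is_weak_extent Y K /\ countable K.

(* The metric structure [m] lives on the bare carrier of [X]: the topology [tau]
   it induces is unrelated to the one [X] may already have. *)
Definition metrizable_topology (R : realType) (X : Type) (tau : set (set X)) :
    Prop :=
  exists m : Metric.axioms_ R X, tau = @open (Metric.Pack m).

Definition submetrizable (R : realType) (X : topologicalType) : Prop :=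
  exists2 tau : set (set X), metrizable_topology R tau & tau `<=` open.

(* Main.v *)
Require Import Defs.
From HB Require Import structures.
From mathcomp Require Import all_boot all_order all_algebra.
From mathcomp Require Import all_classical all_reals all_analysis.
From mathcomp Require Import lra.

(* Let f vanish exactly on the diagonal. Each p off the diagonal has a
   neighbourhood W with f (a.1, b.1) < f (a.1, b.2) for all a, b in W, because at
   a = b = p this reads f (p.1, p.1) = 0 < f p. For every n, these sets W and
   {f < 1/(n+1)} cover X^2. If A n is countable and meets enough members of this
   cover, then f (x, y) >= 1/(n+1) yields a in A n with f (a.1, x) < f (a.1, y).
   So the countably many continuous functions f (a.1, -), with a in some A n,
   separate the points of X, and they define a coarser metric topology. *)

Set Implicit Arguments.
Unset Strict Implicit.
Unset Printing Implicit Defensive.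

Import Order.TTheory GRing.Theory Num.Theory.
Import numFieldNormedType.Exports.

Local Open Scope classical_set_scope.
Local Open Scope ring_scope.

Section dist_topology.
Context {R : realType} {T : choiceType} (d : T -> T -> R).
Hypotheses (dxx : forall x, d x x = 0) (d0 : forall x y, d x y = 0 -> x = y).
Hypothesis dC : forall x y, d x y = d y x.
Hypothesis dD : forall y x z, d x z <= d x y + d y z.

(* A copy of T, so that the topology of d does not clash with one already
   attached to T. *)
Let distT : Type := T.

HB.instance Definition _ := Choice.on distT.
HB.instance Definition _ := isMetric.Build R distT dxx d0 dC dD.

(** Describing open sets by [d]-balls lets a comparison with another topology on [T] be checked on
    these balls alone. *)
Lemma metric_axioms_of_dist : exists m : Metric.axioms_ R T, forall A : set T,
  @open (Metric.Pack m) A ->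
  forall x, A x -> exists2 e, 0 < e & [set y | d x y < e] `<=` A.
Proof.
exists (Metric.class (distT : metricType R)) => A oA x Ax.
have /nbhs_ballP[e e0 eA] : nbhs (x : (distT : metricType R)) A.
  exact: open_nbhs_nbhs.
by exists e => // y dxy; apply: eA.
Qed.

End dist_topology.

Section sup_dist.
Context {R : realType} {T : Type} (g : nat -> T -> R).

Let term (x y : T) (n : nat) : R := Num.min `|g n x - g n y| n.+1%:R^-1.

Let terms (x y : T) : set R := range (term x y).

(* Truncating the n-th term at 1/(n+1) makes small balls depend on finitely many
   of the g n only. *)
Definition sup_dist (x y : T) : R := sup (terms x y).

Let terms_has_sup x y : has_sup (terms x y).
Proof.
split; first by exists (term x y 0); exists 0%N.
exists 1 => _ [n _ <-]; rewrite ge_min; apply/orP; right.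
by rewrite invf_le1// ler1n.
Qed.

Let term_le_dist x y n : term x y n <= sup_dist x y.
Proof. by apply: ub_le_sup; [case: (terms_has_sup x y)|exists n]. Qed.

Let dist_le x y e : (forall n, term x y n <= e) -> sup_dist x y <= e.
Proof.
move=> le_e; apply: ge_sup; first by case: (terms_has_sup x y).
by move=> _ [n _ <-].
Qed.

Let term_ge0 x y n : 0 <= term x y n.
Proof. by rewrite le_min normr_ge0 invr_ge0 ler0n. Qed.

Lemma sup_distxx x : sup_dist x x = 0.
Proof.
apply/eqP; rewrite eq_le (le_trans (term_ge0 x x 0) (term_le_dist _ _ _)) andbT.
by apply: dist_le => n; rewrite /term subrr normr0 ge_min lexx.
Qed.

Lemma sup_distC x y : sup_dist x y = sup_dist y x.
Proof.
rewrite /sup_dist /terms; suff -> : term x y = term y x by [].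
by apply/funext => n; rewrite /term distrC.
Qed.

Lemma sup_dist_triangle y x z : sup_dist x z <= sup_dist x y + sup_dist y z.
Proof.
apply: dist_le => n.
apply: le_trans (lerD (term_le_dist x y n) (term_le_dist y z n)).
have := ler_distD (g n y) (g n x) (g n z).
have : 0 <= n.+1%:R^-1 :> R by rewrite invr_ge0.
have := normr_ge0 (g n x - g n y); have := normr_ge0 (g n y - g n z).
rewrite /term; move: (n.+1%:R^-1) => c; rewrite !minElt => ? ? ? ?.
(* Truncation at [c >= 0] is subadditive on nonnegative reals; the cases say which argument attains
   each of the three minima. *)
by do 3 (case: ifPn; rewrite -?leNgt => ?); lra.
Qed.

(** The cap 1/(n+1) is positive, so a term can vanish only through its absolute value. *)
Lemma sup_dist_eq0 x y : sup_dist x y = 0 -> forall n, g n x = g n y.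
Proof.
move=> d0 n; have := term_le_dist x y n.
rewrite d0 /term ge_min normr_le0 subr_eq0 => /orP[/eqP//|].
by rewrite leNgt invr_gt0 ltr0n.
Qed.

(** From index [N] on, the cap alone keeps the terms below 1/(N+1), whatever the [g n] are. *)
Lemma sup_dist_le x y e N : (forall n, (n < N)%N -> `|g n x - g n y| <= e) ->
  N.+1%:R^-1 <= e -> sup_dist x y <= e.
Proof.
move=> le_e Ne; apply: dist_le => n; rewrite ge_min.
have [/le_e->//|Nn] := ltnP n N.
apply/orP; right; apply: le_trans Ne.
by rewrite lef_pV2 ?posrE// ler_nat ltnS.
Qed.

End sup_dist.

Lemma near_sup_dist (R : realType) (X : topologicalType) (g : nat -> X -> R)
    (x : X) (e : R) : (forall n, {for x, continuous (g n)}) -> 0 < e ->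
  \forall y \near x, sup_dist g x y < e.
Proof.
move=> gx e0.
have [N Ne] : exists N : nat, N.+1%:R^-1 <= e / 2.
  have e20 : 0 < e / 2 by rewrite divr_gt0.
  have [N _ /(_ N (leqnn N)) Ne] := near_infty_natSinv_lt (PosNum e20).
  by exists N; apply: ltW.
(* A supremum inherits only non-strict bounds from its terms, hence the margin [e / 2]. *)
near=> y; apply: (@le_lt_trans _ _ (e / 2)); last by lra.
(* Indexing by ['I_N] turns the condition on [y] into a finite intersection of neighbourhoods of
   [x]. *)
apply: (sup_dist_le _ Ne) => n nN; rewrite -[n]/(nat_of_ord (Ordinal nN)).
move: (Ordinal nN); near: y; apply: filter_forall => i.
by move: (gx i) => /cvgrPdist_le/(_ (e / 2)); apply; rewrite divr_gt0.
Unshelve. all: by end_near. Qed.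

Lemma countable_separating_submetrizable (R : realType) (X : topologicalType)
    (g : nat -> X -> R) : (forall n, continuous (g n)) ->
  (forall x y, (forall n, g n x = g n y) -> x = y) -> submetrizable R X.
Proof.
move=> gc gsep.
have [|m openm] := @metric_axioms_of_dist R X (sup_dist g) (sup_distxx g) _
  (sup_distC g) (sup_dist_triangle g).
  by move=> x y dxy; apply: gsep => n; apply: sup_dist_eq0 dxy n.
exists (@open (Metric.Pack m)); first by exists m.
move=> A /openm Aball; rewrite openE => x /Aball[e e0 eA].
by apply: filterS eA _; apply: near_sup_dist => // n; apply: gc.
Qed.

Lemma star_separating_cover (R : realType) (X : topologicalType)
    (f : X * X -> R) (r : R) : continuous f -> 0 < r ->
    (forall x, f (x, x) = 0) ->
  open_cover [set W : set (X * X) | open W /\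
    (W `<=` [set p | f p < r] \/
     forall a b, W a -> W b -> f (a.1, b.1) < f (a.1, b.2))].
Proof.
move=> fc r0 fxx; split => [W []//|]; apply/seteqP; split => // p _.
have [fpr|rfp] := ltP (f p) r.
  exists [set p | f p < r] => //; split; last by left.
  exact: (open_comp (fun p _ => fc p) (@open_lt _ r)).
(* At [(p, p)] the value of [h] is [f p - f (p.1, p.1) = f p >= r > 0]. *)
pose h (q : (X * X) * (X * X)) := f (q.1.1, q.2.2) - f (q.1.1, q.2.1).
have hc : continuous h.
  have fpair (u v : (X * X) * (X * X) -> X) :
      continuous u -> continuous v -> continuous (fun q => f (u q, v q)).
    move=> uc vc q; apply: (@continuous_comp _ _ _ (fun q => (u q, v q)) f).
      by apply: cvg_pair; [exact: uc|exact: vc].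
    exact: fc.
  have c11 (q : (X * X) * (X * X)) : {for q, continuous (fun q => q.1.1)}.
    by apply: (continuous_comp (f := fst) (g := fst)); exact: cvg_fst.
  have c21 (q : (X * X) * (X * X)) : {for q, continuous (fun q => q.2.1)}.
    apply: (continuous_comp (f := snd) (g := fst)); first exact: cvg_snd.
    exact: cvg_fst.
  have c22 (q : (X * X) * (X * X)) : {for q, continuous (fun q => q.2.2)}.
    by apply: (continuous_comp (f := snd) (g := snd)); exact: cvg_snd.
  by move=> q; apply: cvgB; apply: fpair.
have : \forall q \near (p, p), 0 < h q.
  by apply: (cvgr_gt _ (hc (p, p))); rewrite /h /= fxx subr0 -surjective_pairing
    (lt_le_trans r0).
move=> [[V W] /= [pV pW] VW].
(* The box gives different neighbourhoods for [a] and [b]; intersecting them makes one set serve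
   both. *)
exists ((V `&` W)^°); last by apply: filterI.
split; first exact: open_interior.
right => a b /interior_subset[Va _] /interior_subset[_ Wb].
by rewrite -subr_gt0; apply: (VW (a, b)).
Qed.

Lemma countable_we_separating (R : realType) (X : topologicalType)
    (f : X * X -> R) : continuous f -> (forall p, 0 <= f p) ->
    f @^-1` [set 0] = diagonal -> countable_weak_extent (X * X)%type ->
  exists g : nat -> X -> R, (forall n, continuous (g n)) /\
    forall x y, (forall n, g n x = g n y) -> x = y.
Proof.
move=> fc f0 fdiag [T [K [[Kwe _] Kc]]].
have fxx x : f (x, x) = 0 by have : diagonal (x, x) by []; rewrite -fdiag.
have /choice[A AP] (n : nat) : exists A : set (X * X), countable A /\
    forall p, n.+1%:R^-1 <= f p -> exists2 a, A a & f (a.1, p.1) < f (a.1, p.2).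
  have [|A AK starA] := Kwe _ (@star_separating_cover _ _ f n.+1%:R^-1 fc _ fxx).
    by rewrite invr_gt0.
  exists A; split; first exact: sub_countable AK Kc.
  move=> p rfp; have : [set: X * X] p by [].
  (* The member [W] contains both [p] and a point [a] of [A]. If [W] lies in the region where [f] is
     small, this contradicts [rfp]; otherwise its defining inequality applies to [a] and [p]. *)
  rewrite -starA => -[W [[oW [Wr|Wf]] [a [Aa Wa]]] Wp]; last by exists a => //; apply: Wf.
  by have /= := Wr _ Wp; rewrite ltNge rfp.
pose B := \bigcup_n A n.
have Bsep x y : x != y -> exists2 a, B a & f (a.1, x) < f (a.1, y).
  move=> xy; have fxy : 0 < f (x, y).
    rewrite lt_neqAle f0 andbT eq_sym; apply/eqP => fxy0.
    have : diagonal (x, y) by rewrite -fdiag.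
    by move/eqP; rewrite /= (negPf xy).
  have [N _ /(_ N (leqnn N)) /= /ltW Nfxy] := near_infty_natSinv_lt (PosNum fxy).
  have [_ /(_ (x, y) Nfxy)[a Aa fa]] := AP N.
  by exists a => //; exists N.
have fac (a : X) : continuous (fun x => f (a, x)).
  move=> x; apply: (@continuous_comp _ _ _ (fun x => (a, x)) f); last exact: fc.
  by apply: cvg_pair => //; apply: cvg_cst.
have : countable B by apply: bigcup_countable => // n _; case: (AP n).
(* Either [B] is empty, and then [Bsep] leaves at most one point in [X], so constants separate; or
   [e] enumerates [B], possibly with repetitions. *)
move=> /pfcard_geP[B0|[e]].
  exists (fun _ _ => 0); split=> [n|x y _]; first exact: cst_continuous.
  by apply/eqP; apply: contraT => /Bsep[a]; rewrite B0.
exists (fun n x => f ((e n).1, x)); split=> [n|x y gxy]; first exact: fac.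
apply/eqP; apply: contraT => /Bsep[a Ba].
by have [n _ <-] := @surj _ _ _ _ e a Ba; rewrite gxy ltxx.
Qed.

Theorem corollary3p4 (R : realType) (X : topologicalType)
    (hdiag : zero_set_diagonal R X)
    (hwe : countable_weak_extent (X * X)%type) :
  submetrizable R X.
Proof.
have [f [fc f01 fdiag]] := hdiag.
have f0 p : 0 <= f p.
  by have /= := f01 (f p) (imageT _ _); rewrite in_itv => /andP[].
have [g [gc gsep]] := countable_we_separating fc f0 fdiag hwe.
exact: countable_separating_submetrizable gc gsep.
Qed.
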